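(* Let $m$ be a positive integer, and let $a$ be an integer that can be written as a sum of $3$ squares modulo $m$, i.e. there exist integers $z_1,z_2,z_3$ with $z_1^2+z_2^2+z_3^2\equiv a \pmod m$. Then there exists a constant $c_m>0$, depending only on $m$, such that there are infinitely many positive integers $n\equiv a \pmod m$ satisfying \[ r_3(n) \geq c_m \sqrt{n}\,\log\log n. \]
   Context: For a positive integer $n$, $r_3(n) := |\{(a,b,c)\in\mathbb{Z}^3 : a^2+b^2+c^2=n\}|$ denotes the number of representations of $n$ as a sum of three squares (counting signs and order). *)

(* Defs.v *)
From Stdlib Require Import Reals ZArith List Lia.
Import ListNotations.

(* Integers in the range [-n, n]. Any (a,b,c) with a^2+b^2+c^2 = n
   satisfies |a|,|b|,|c| <= n, so counting in this box is exact. *)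
Definition box (n : nat) : list Z :=
  map (fun k => (Z.of_nat k - Z.of_nat n)%Z) (seq 0 (2 * n + 1)).

Definition r3 (n : nat) : nat :=
  length (filter
    (fun t : Z * (Z * Z) =>
       let '(a, (b, c)) := t in Z.eqb (a * a + b * b + c * c) (Z.of_nat n))
    (list_prod (box n) (list_prod (box n) (box n)))).

Definition sum3sq_mod (m a : Z) : Prop :=
  exists z1 z2 z3 : Z, ((z1 ^ 2 + z2 ^ 2 + z3 ^ 2) mod m = a mod m)%Z.

(* Main.v *)
Require Import Defs.
From Stdlib Require Import Reals ZArith List Lia Lra.
From mathcomp Require all_boot all_order all_algebra reals Rstruct zify ring lra.
Open Scope R_scope.

(** Work modulo [M = m D], where [D] is the product of the primes [p <= y] not
    dividing [2 m].  The congruence [x^2 + y^2 + z^2 = -1] has at least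
    [p^2 + p] solutions modulo such a [p], so by the Chinese remainder theorem
    there are at least [D^2 prod (1 + 1/p)] triples in the cube [[0, M)^3] lying
    in a fixed class modulo [m] and solving it modulo [D].  Their sums of squares
    are below [3 M^2] and in one class modulo [M], so take at most [3 M] values;
    hence some such [n] has [r3 n >= D prod (1 + 1/p) / (3 m)].  By Euler's
    product, [prod (1 + 1/p)] is at least a constant times
    [sum_(k <= y) 1/k >= log y], while [D <= y^y] gives [log log n <= 3 log y]
    for large [y]. *)

(** This is [1 + u <= exp u] at [u = / x]. Summed over the integers, it bounds the logarithm by the
    harmonic sum. *)
Lemma ln_succ_le (x : R) : 0 < x -> ln (x + 1) <= ln x + / x.
Proof.
intros Hx.
replace (x + 1) with (x * (1 + / x)) by (field; lra).
assert (Hi : (0 < / x)) by now apply Rinv_0_lt_compat.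
rewrite ln_mult by lra; apply Rplus_le_compat_l.
rewrite <- (ln_exp (/ x)) at 2.
left; apply ln_increasing; [lra | apply exp_ineq1; lra].
Qed.

Module CountingModulo.

Import all_boot all_order all_algebra reals Rstruct zify ring lra.
Set Implicit Arguments.
Unset Strict Implicit.
Unset Printing Implicit Defensive.
Import Order.TTheory GRing.Theory Num.Theory.
Local Open Scope ring_scope.

(** * Sums of squares over a finite field *)

(** Choosing one root of each square gives a set [T] such that [T] and [-T] cover the field, since
    elements with equal squares agree up to sign. Both sets contain 0, whence the strict
    inequality. *)
Lemma card_squares (F : finFieldType) :
  (#|F| < 2 * #|[set x ^+ 2 | x : F]|)%N.
Proof.
(* The default 0 is never taken on a square, where [pick] finds a root. *)
pose sqrt_of (s : F) := odflt 0 [pick y : F | y ^+ 2 == s].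
pose T := sqrt_of @: [set x ^+ 2 | x : F].
have sqrtE (x : F) : sqrt_of (x ^+ 2) ^+ 2 = x ^+ 2.
  by rewrite /sqrt_of; case: pickP => [y /eqP //|/(_ x)]; rewrite eqxx.
have T0 : 0 \in T.
  apply/imsetP; exists (0 ^+ 2); first by apply: imset_f.
  by apply/esym/eqP; rewrite -sqrf_eq0 sqrtE expr0n.
have cover : [set: F] = T :|: [set - x | x in T].
  apply/setP => x; rewrite !inE; apply/esym.
  have Tx : sqrt_of (x ^+ 2) \in T by apply/imset_f/imset_f.
  have /eqP := sqrtE x; rewrite eqf_sqr => /orP[] /eqP E.
    by rewrite -{1}E Tx.
  by apply/orP; right; apply/imsetP; exists (sqrt_of (x ^+ 2)) => //; rewrite E opprK.
have meet0 : (0 < #|T :&: [set - x | x in T]|)%N.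
  apply/card_gt0P; exists 0; rewrite inE T0 /=.
  by apply/imsetP; exists 0; rewrite ?oppr0.
have cardN : #|[set - x | x in T]| = #|T| by apply/card_imset/oppr_inj.
have := cardsUI T [set - x | x in T].
rewrite -cover cardsT cardN.
have : (#|T| <= #|[set x ^+ 2 | x : F]|)%N by apply: leq_imset_card.
move=> leTS UI; apply: (@leq_trans (#|T| + #|T|)).
  by rewrite -UI -addn1 leq_add2l.
by rewrite mul2n -addnn leq_add.
Qed.

(** By [card_squares], the set [S] of squares and its reflection [c - S] have together more than
    [#|F|] elements, so they meet. *)
Lemma sum_two_squares_finField (F : finFieldType) (c : F) :
  exists x y : F, x ^+ 2 + y ^+ 2 = c.
Proof.
pose S := [set x ^+ 2 | x : F]; pose S' := [set c - s | s in S].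
have cardS' : #|S'| = #|S| by apply: card_imset => x y /addrI/oppr_inj.
have : S :&: S' != set0.
  have lt_card : (#|F| < #|S| + #|S'|)%N.
    by rewrite cardS' addnn -mul2n card_squares.
  rewrite -card_gt0 -(ltn_add2l #|S :|: S'|) addn0 cardsUI.
  by apply: leq_ltn_trans lt_card; apply: max_card.
case/set0Pn => s /setIP[/imsetP[x _ ->]] /imsetP[_ /imsetP[y _ ->] E].
by exists x, y; rewrite E subrK.
Qed.

(* With [al ^+ 2 + be ^+ 2 = -1], the quaternion algebra is split and the
   sum of three squares is the norm form [- (a ^+ 2 + b * c)] on trace-zero
   matrices; the latter takes the value -1 at q (q + 1) explicit points. *)
Lemma three_squares_finField (F : finFieldType) : (2%:R : F) != 0 ->
  (#|F| * #|F|.+1 <=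
   #|[set t : F * F * F | (t.1.1 ^+ 2 + t.1.2 ^+ 2 + t.2 ^+ 2 == -1)%R]|)%N.
Proof.
move=> two_neq0; have [al [be alb]] := sum_two_squares_finField (-1 : F).
(* [f] parametrizes the quadric [a ^+ 2 + b * c = 1]. A nonzero [b] leaves [a = t] free and
   determines [c]; when [b = 0], [c = t] is free and [a] is 1 or -1, coded by [Some 0] and
   [None]. *)
pose f (u : F * option F) : F * F * F := match u with
  | (t, Some b) => if b == 0 then (1, 0, t) else (t, b, (1 - t ^+ 2) / b)
  | (t, None) => (-1, 0, t) end.
have fE u : (f u).1.1 ^+ 2 + (f u).1.2 * (f u).2 = 1.
  case: u => t [b|] /=; last by ring.
  by case: eqP => [_|/eqP b0] /=; [ring | field].
have one_opp : (1 : F) <> -1.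
  by move=> E; move: two_neq0; rewrite -[2%:R]/(1 + 1) {1}E addNr eqxx.
have f_inj : injective f.
  move=> [t [b|]] [t' [b'|]] /=.
  - case: eqP => [->|b0]; case: eqP => [->|b0'] //.
    + by case=> ->.
    + by case=> _ E; case: b0'.
    + by case=> _ E; case: b0.
    + by case=> -> ->.
  - case: eqP => [_|b0]; first by case=> /one_opp.
    by case=> _ E; case: b0.
  - case: eqP => [_|b0]; first by case=> /esym/one_opp.
    by case=> _ E; case: b0.
  - by case=> ->.
(* Because [al ^+ 2 + be ^+ 2 = -1], the linear map [g] pulls the sum of three squares back to
   [- (a ^+ 2 + b * c)]; [h] inverts it. *)
pose g (v : F * F * F) : F * F * F :=
  let a := v.1.1 in let e := (v.1.2 + v.2) / 2%:R in
  ((v.1.2 - v.2) / 2%:R, - (al * a + be * e), - (be * a - al * e)).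
pose h (w : F * F * F) : F * F * F :=
  let e := be * w.1.2 - al * w.2 in (al * w.1.2 + be * w.2, w.1.1 + e, e - w.1.1).
have gK : cancel g h.
  move=> [[a b] c]; rewrite /g /h /=; congr (_, _, _).
  - transitivity (- (al ^+ 2 + be ^+ 2) * a); first by field.
    by rewrite alb; ring.
  - transitivity ((b - c) / 2%:R - (al ^+ 2 + be ^+ 2) * ((b + c) / 2%:R)).
      by field.
    by rewrite alb; field.
  - transitivity (- (b - c) / 2%:R - (al ^+ 2 + be ^+ 2) * ((b + c) / 2%:R)).
      by field.
    by rewrite alb; field.
have -> : (#|F| * #|F|.+1)%N = #|(g \o f) @: [set: F * option F]|.
  rewrite card_imset; last exact: inj_comp (can_inj gK) f_inj.
  by rewrite cardsT card_prod card_option.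
apply/subset_leq_card/subsetP => _ /imsetP[u _ ->]; rewrite inE /=.
move: (fE u); case: (f u) => [[a b] c] /= E; apply/eqP.
transitivity (((b - c) / 2%:R) ^+ 2 +
  (al ^+ 2 + be ^+ 2) * (a ^+ 2 + ((b + c) / 2%:R) ^+ 2)).
  by ring.
by rewrite alb -[in RHS]E; field.
Qed.

Local Close Scope ring_scope.
Local Open Scope nat_scope.

(** * Solutions modulo an integer and the Chinese remainder theorem *)

Definition sqsum (t : nat * (nat * nat)) := t.1 ^ 2 + t.2.1 ^ 2 + t.2.2 ^ 2.

Definition cube (M : nat) : seq (nat * (nat * nat)) :=
  [seq (x, yz) | x <- iota 0 M, yz <- [seq (y, z) | y <- iota 0 M, z <- iota 0 M]].

(** The sum of squares is -1 modulo [D]. For [c] nonzero modulo an odd prime [p], the value [c] has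
    [p^2 + (-c/p) p] representations, with a Legendre symbol, so -1 gets the larger count at every
    odd [p]. *)
Definition sols (D : nat) := [seq t <- cube D | D %| (sqsum t).+1].

Lemma mem_cube M t : (t \in cube M) = [&& t.1 < M, t.2.1 < M & t.2.2 < M].
Proof.
case: t => x [y z] /=; apply/allpairsP/and3P => [[[x' [y' z']]] /= [Hx]|[Hx Hy Hz]].
  case/allpairsP => -[y'' z''] /= [Hy Hz [-> ->]] [-> -> ->].
  by move: Hx Hy Hz; rewrite !mem_iota.
exists (x, (y, z)); rewrite mem_iota; split=> //.
by apply/allpairsP; exists (y, z); rewrite !mem_iota.
Qed.

Lemma cube_uniq M : uniq (cube M).
Proof.
apply: allpairs_uniq; rewrite ?iota_uniq //; last by case=> ? ? [].
by apply: allpairs_uniq; rewrite ?iota_uniq //; case=> ? ? [].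
Qed.

Lemma mem_sols D t : (t \in sols D) = (D %| (sqsum t).+1) && (t \in cube D).
Proof. by rewrite mem_filter. Qed.

Lemma sols_uniq D : uniq (sols D).
Proof. exact/filter_uniq/cube_uniq. Qed.

Lemma sols_prime p : prime p -> odd p -> p * p.+1 <= size (sols p).
Proof.
move=> p_pr p_odd.
have two_neq0 : (2%:R : 'F_p)%R != 0%R.
  rewrite -(dvdn_pcharf (pchar_Fp p_pr)) dvdn_prime2 //.
  by apply/eqP => p2; rewrite p2 in p_odd.
have := three_squares_finField two_neq0; rewrite card_Fp //.
move/leq_trans; apply; rewrite cardE.
pose f (t : 'F_p * 'F_p * 'F_p) : nat * (nat * nat) :=
  (t.1.1 : nat, (t.1.2 : nat, t.2 : nat)).
have f_inj : injective f.
  by move=> [[a b] c] [[a' b'] c'] [] /val_inj -> /val_inj -> /val_inj ->.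
rewrite -(size_map f); apply: uniq_leq_size.
  by rewrite map_inj_uniq // enum_uniq.
move=> _ /mapP[[[a b] c] + ->]; rewrite mem_enum inE /= => /eqP E.
rewrite mem_sols mem_cube /= (dvdn_pcharf (pchar_Fp p_pr)) /sqsum /=.
have lt_p (x : 'F_p) : x < p by rewrite -[X in _ < X](Fp_cast p_pr).
rewrite !lt_p !andbT -natr1 !natrD !natrX !natr_Zp E.
by rewrite addNr.
Qed.

Section CRT.
Variables (D1 D2 : nat).
Hypothesis co_D : coprime D1 D2.
Hypotheses (D1_gt0 : 0 < D1) (D2_gt0 : 0 < D2).

(** [chinese] need not return a reduced residue; the remainder brings the result into the range of
    the cube. *)
Definition crt x y := chinese D1 D2 x y %% (D1 * D2).
Definition crt3 (t u : nat * (nat * nat)) :=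
  (crt t.1 u.1, (crt t.2.1 u.2.1, crt t.2.2 u.2.2)).

Lemma crt_modl x y : crt x y = x %[mod D1].
Proof. by rewrite /crt modn_dvdm ?dvdn_mulr // chinese_modl. Qed.

Lemma crt_modr x y : crt x y = y %[mod D2].
Proof. by rewrite /crt modn_dvdm ?dvdn_mull // chinese_modr. Qed.

Lemma crt3_cube t u : crt3 t u \in cube (D1 * D2).
Proof. by rewrite mem_cube /= !ltn_pmod // muln_gt0 D1_gt0. Qed.

Lemma sqsum_mod d t u : t.1 = u.1 %[mod d] -> t.2.1 = u.2.1 %[mod d] ->
  t.2.2 = u.2.2 %[mod d] -> sqsum t = sqsum u %[mod d].
Proof.
move=> E1 E2 E3; rewrite /sqsum.
have sq x y : x = y %[mod d] -> x ^ 2 = y ^ 2 %[mod d].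
  by move=> E; rewrite -modnXm E modnXm.
have add x y x' y' : x = x' %[mod d] -> y = y' %[mod d] -> x + y = x' + y' %[mod d].
  by move=> Ex Ey; rewrite -modnDm Ex Ey modnDm.
by apply: (add); [apply: add |]; apply: sq.
Qed.

Lemma sqsum_crt3l t u : sqsum (crt3 t u) = sqsum t %[mod D1].
Proof. by apply: sqsum_mod; apply: crt_modl. Qed.

Lemma sqsum_crt3r t u : sqsum (crt3 t u) = sqsum u %[mod D2].
Proof. by apply: sqsum_mod; apply: crt_modr. Qed.

Lemma crt_inj x y x' y' : x < D1 -> x' < D1 -> y < D2 -> y' < D2 ->
  crt x y = crt x' y' -> x = x' /\ y = y'.
Proof.
move=> lx lx' ly ly' E.
have := crt_modl x y; have := crt_modr x y.
by rewrite E crt_modl crt_modr !modn_small.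
Qed.

Lemma crt3_inj t u t' u' : t \in cube D1 -> t' \in cube D1 ->
  u \in cube D2 -> u' \in cube D2 -> crt3 t u = crt3 t' u' -> t = t' /\ u = u'.
Proof.
rewrite !mem_cube.
case: t t' u u' => x [y z] [x' [y' z']] [a [b c]] [a' [b' c']] /=.
move=> /and3P[? ? ?] /and3P[? ? ?] /and3P[? ? ?] /and3P[? ? ?] [].
by do 3 (case/crt_inj => // -> ->).
Qed.

(** Gluing coordinate by coordinate is injective on pairs of cube points, and divisibility by the
    coprime [D1] and [D2] gives divisibility by their product. *)
Lemma sols_mul : size (sols D1) * size (sols D2) <= size (sols (D1 * D2)).
Proof.
rewrite -(size_allpairs crt3); apply: uniq_leq_size.
  apply: allpairs_uniq; rewrite ?sols_uniq //.
  move=> [t u] [t' u'] /allpairsP[[a b] /= [+ + [-> ->]]].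
  rewrite !mem_sols => /andP[_ Ha] /andP[_ Hb].
  case/allpairsP=> [[a' b'] /= [+ + [-> ->]]].
  rewrite !mem_sols => /andP[_ Ha'] /andP[_ Hb'].
  by case/crt3_inj => // -> ->.
move=> _ /allpairsP[[t u] /= [+ + ->]]; rewrite !mem_sols => /andP[Ht _] /andP[Hu _].
rewrite crt3_cube Gauss_dvd // andbT; apply/andP; split.
  by rewrite /dvdn -addn1 -modnDml sqsum_crt3l modnDml addn1.
by rewrite /dvdn -addn1 -modnDml sqsum_crt3r modnDml addn1.
Qed.

End CRT.

(** The local counts [p * p.+1] multiply. With [D] the product of the primes, the bound is
    [D^2 prod (1 + 1/p)], kept integral. *)
Lemma sols_prod (s : seq nat) : uniq s -> all (fun p => prime p && odd p) s ->
  \prod_(p <- s) p * \prod_(p <- s) p.+1 <= size (sols (\prod_(p <- s) p)).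
Proof.
elim: s => [|p s IH] /=; first by rewrite !big_nil.
move=> /andP[ps s_uniq] /andP[/andP[p_pr p_odd] s_pr]; rewrite !big_cons.
have s_gt0 : 0 < \prod_(q <- s) q.
  rewrite big_seq; apply: prodn_cond_gt0 => q qs.
  by have /andP[/prime_gt0] := allP s_pr q qs.
apply: leq_trans (sols_mul _ (prime_gt0 p_pr) s_gt0).
  by rewrite mulnACA leq_mul ?sols_prime ?IH.
rewrite big_seq; apply: (big_rec (coprime p)) => [|q n qs co_pn].
  exact: coprimen1.
have /andP[q_pr _] := allP s_pr q qs.
rewrite coprimeMr co_pn andbT prime_coprime // dvdn_prime2 //.
by apply: contraNneq ps => ->.
Qed.

(** * A popular value by the pigeonhole principle *)

Lemma sum_count (T : Type) (f : T -> nat) K (s : seq T) :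
  all (fun t => f t < K) s -> \sum_(v < K) count (fun t => f t == v) s = size s.
Proof.
elim: s => [|t s IH] /=; first by rewrite big1.
case/andP=> ft /IH {}IH; rewrite big_split /= IH (bigD1 (Ordinal ft)) //= eqxx.
rewrite big1 // => i; rewrite -val_eqE /= eq_sym => /negPf ne.
by rewrite ne.
Qed.

Lemma pigeonhole_count (T : Type) (f : T -> nat) K (s : seq T) :
  0 < K -> all (fun t => f t < K) s ->
  exists2 v, v < K & size s <= K * count (fun t => f t == v) s.
Proof.
case: K => // K _ fs; rewrite -(sum_count fs).
have [v _ max_v] :=
  arg_maxnP (fun v : 'I_K.+1 => count (fun t => f t == v) s) (erefl : xpredT ord0).
exists v => //; rewrite -[X in _ <= X * _]card_ord -sum_nat_const.
by apply: leq_sum => i _; apply: max_v.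
Qed.

(** [z] fixes the class modulo [m] while the solutions modulo [D] vary. At least [D * psi] triples
    share at most [3 * m * D] sums of squares, so one sum occurs at least [psi / (3 m)] times. *)
Lemma popular_value m z (s : seq nat) : 0 < m -> uniq s ->
  all (fun p => [&& prime p, odd p & coprime m p]) s ->
  exists n, [/\ n < 3 * (m * \prod_(p <- s) p) ^ 2, n = sqsum z %[mod m] &
    \prod_(p <- s) p.+1 <=
      3 * m * count (fun t => sqsum t == n) (cube (m * \prod_(p <- s) p))].
Proof.
move=> m_gt0 s_uniq s_pr.
have s_odd : all (fun p => prime p && odd p) s.
  by apply: sub_all s_pr => p /and3P[-> ->].
have co_mD : coprime m (\prod_(p <- s) p).
  rewrite big_seq; apply: (big_rec (coprime m)) => [|q n qs co]; first exact: coprimen1.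
  by have /and3P[_ _ co_q] := allP s_pr q qs; rewrite coprimeMr co_q.
have D_gt0 : 0 < \prod_(p <- s) p.
  rewrite big_seq; apply: prodn_cond_gt0 => q qs.
  by have /and3P[/prime_gt0] := allP s_pr q qs.
have := sols_prod s_uniq s_odd.
move: (\prod_(p <- s) p.+1) (\prod_(p <- s) p) D_gt0 co_mD => psi D D_gt0 co_mD le_sols.
pose z' := (z.1 %% m, (z.2.1 %% m, z.2.2 %% m)).
have z'_cube : z' \in cube m by rewrite mem_cube /= !ltn_pmod.
pose M := m * D; have M_gt0 : 0 < M by rewrite muln_gt0 m_gt0.
pose L := [seq crt3 m D z' t | t <- sols D].
have L_uniq : uniq L.
  rewrite map_inj_in_uniq ?sols_uniq // => t u; rewrite !mem_sols.
  by move=> /andP[_ t_cube] /andP[_ u_cube] /crt3_inj[].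
(* The common residue modulo [M] of all sums of squares from [L]: that of [sqsum z] modulo [m], and
   [D.-1], that is -1, modulo [D]. *)
pose r := chinese m D (sqsum z) D.-1 %% M.
have sqsumL t : t \in L -> sqsum t %% M = r.
  case/mapP=> u; rewrite mem_sols => /andP[Du _] ->.
  apply/eqP; rewrite chinese_remainder // chinese_modl // chinese_modr //.
  rewrite sqsum_crt3l // sqsum_crt3r //; apply/andP; split.
    by apply/eqP/sqsum_mod; rewrite /= modn_mod.
  by rewrite -(eqn_modDr 1) !addn1 prednK // modnn; apply: Du.
have sqsum_lt t : t \in cube M -> sqsum t < 3 * M ^ 2.
  have sq x : x < M -> x ^ 2 < M ^ 2 by move=> x_lt; rewrite ltn_exp2r.
  rewrite mem_cube /sqsum => /and3P[/sq + /sq + /sq].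
  by move: (t.1 ^ 2) (t.2.1 ^ 2) (t.2.2 ^ 2) (M ^ 2) => a b c Q; lia.
have cubeL t : t \in L -> t \in cube M by case/mapP=> u _ ->; apply: crt3_cube.
(* The residue being fixed, a sum of squares is determined by its quotient by [M]; the pigeonhole
   runs over these quotients. *)
have f_lt : all (fun t => sqsum t %/ M < 3 * M) L.
  by apply/allP => t /cubeL/sqsum_lt; rewrite ltn_divLR // -mulnA.
have [|v v_lt le_v] := pigeonhole_count _ f_lt; first by rewrite muln_gt0.
exists (v * M + r); split.
- have : r < M by rewrite ltn_pmod.
  by nia.
- have /eqP Mm : m %| v * M by rewrite dvdn_mull // dvdn_mulr.
  rewrite -modnDml Mm add0n.
  by rewrite modn_dvdm ?dvdn_mulr // chinese_modl.
- rewrite -(leq_pmul2l D_gt0); apply: (leq_trans le_sols).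
  rewrite -(size_map (crt3 m D z')); apply: (leq_trans le_v).
  have -> : D * (3 * m * count (fun t => sqsum t == v * M + r) (cube M)) =
    3 * M * count (fun t => sqsum t == v * M + r) (cube M) by rewrite /M; ring.
  rewrite leq_mul2l -!size_filter; apply/orP; right.
  apply: uniq_leq_size => [|t]; first exact: filter_uniq.
  rewrite !mem_filter => /andP[/eqP <- tL]; rewrite cubeL // andbT.
  by rewrite -(sqsumL t tL) -divn_eq.
Qed.

Local Open Scope ring_scope.

(** * Euler products against the harmonic sum *)

Lemma sum_multiples (V : nmodType) (F : nat -> V) p n : (0 < p)%N ->
  \sum_(1 <= k < n.+1 | (p %| k)%N) F k = \sum_(1 <= j < (n %/ p).+1) F (p * j)%N.
Proof.
move=> p_gt0; elim: n => [|n IH]; first by rewrite div0n !big_geq.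
rewrite big_mkcond big_nat_recr //= -big_mkcond /= IH divnS //.
case: ifP => [p_n|]; last by rewrite add0n addr0.
rewrite add1n [RHS]big_nat_recr //=; congr (_ + F _).
by rewrite -[LHS](divnK p_n) divnS // p_n add1n mulnC.
Qed.

Section Euler.
Variable R : realFieldType.

(** Euler's product, one prime at a time: in the sum [S] for [p :: s], multiples of [p] contribute
    at most [S / p] and the other terms are smooth over [s], so [(1 - 1/p) S] is at most the product
    over [s]. *)
Lemma smooth_harmonic (s : seq nat) n : uniq s -> all prime s ->
  \sum_(1 <= k < n.+1 | all (mem s) (primes k)) (k%:R : R)^-1
    <= \prod_(p <- s) (1 - p%:R^-1)^-1.
Proof.
elim: s => [|p s IH] /=.
  move=> _ _; rewrite big_nil; case: n => [|n]; first by rewrite big_geq.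
  rewrite big_mkcond big_nat_recl //= invr1 big_nat_cond big1 ?addr0 // => k /andP[/andP[k_gt0 _] _].
  case: allP => // no_prime.
  have pdiv_in : pdiv k.+1 \in primes k.+1 by rewrite mem_primes pdiv_prime ?pdiv_dvd.
  by have := no_prime _ pdiv_in.
case/andP=> ps s_uniq /andP[p_pr s_pr]; rewrite big_cons.
have p_gt0 := prime_gt0 p_pr; have p_gt1 := prime_gt1 p_pr.
have pR_gt1 : 1 < (p%:R : R) by rewrite ltr1n.
have pV_lt1 : (p%:R : R)^-1 < 1 by rewrite invf_lt1 ?ltr0n.
pose smooth (t : seq nat) k := all (mem t) (primes k).
set S := \sum_(_ <= _ < _ | _) _.
have S_rough : \sum_(1 <= k < n.+1 | smooth (p :: s) k && ~~ (p %| k)%N) (k%:R : R)^-1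
    <= \sum_(1 <= k < n.+1 | smooth s k) k%:R^-1.
  rewrite [leLHS]big_mkcond [leRHS]big_mkcond /=; apply: ler_sum => k _.
  case: ifP => [/andP[/allP k_smooth p_k]|_]; last by case: ifP => _; rewrite ?invr_ge0.
  rewrite ifT //; apply/allP => q qk; have := k_smooth q qk.
  rewrite !inE => /orP[/eqP q_p|//].
  by move: qk; rewrite mem_primes q_p (negPf p_k) !andbF.
have S_mult : \sum_(1 <= k < n.+1 | smooth (p :: s) k && (p %| k)%N) (k%:R : R)^-1
    <= p%:R^-1 * S.
  rewrite (eq_bigl (fun k => (p %| k)%N && smooth (p :: s) k)); last by move=> k; rewrite andbC.
  rewrite big_mkcondr sum_multiples // mulr_sumr.
  rewrite [leRHS]big_mkcond /=.
  (* Writing [k = p * j], smoothness passes to [j]; the range of [j] is then extended from [n %/ p]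
     to [n] by nonnegative terms. *)
  apply: (@le_trans _ _ (\sum_(1 <= j < (n %/ p).+1)
      if smooth (p :: s) j then (p%:R : R)^-1 * j%:R^-1 else 0)).
    rewrite big_nat_cond [leRHS]big_nat_cond; apply: ler_sum => j /andP[/andP[j_gt0 _] _].
    case: ifP => [/allP k_smooth|_]; last first.
      by case: ifP => _ //; rewrite mulr_ge0 ?invr_ge0.
    rewrite ifT ?natrM ?invfM //; apply/allP => q qj; apply: k_smooth.
    by rewrite primesM // qj orbT.
  rewrite (big_cat_nat _ (n := (n %/ p).+1) (p := n.+1)) //=; last by rewrite ltnS leq_div.
  rewrite lerDl; apply: sumr_ge0 => j _.
  by case: ifP => _ //; rewrite mulr_ge0 ?invr_ge0.
have S_split : S <= p%:R^-1 * S + \prod_(q <- s) (1 - q%:R^-1)^-1.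
  rewrite {1}/S (bigID (fun k => (p %| k)%N)) /=.
  by apply: lerD => //; apply: le_trans S_rough _; apply: IH.
rewrite -ler_pdivrMl ?invr_gt0 ?subr_gt0 // invrK mulrBl mul1r lerBlDl.
exact: S_split.
Qed.

(** Every [k <= n] has only prime factors up to [n], so the smoothness condition holds for all
    terms. *)
Lemma smooth_all_primes n :
  \sum_(1 <= k < n.+1) (k%:R : R)^-1 <= \prod_(1 <= p < n.+1 | prime p) (1 - p%:R^-1)^-1.
Proof.
rewrite -[leRHS]big_filter; apply: le_trans (smooth_harmonic n _ _); last first.
- exact: filter_all.
- exact/filter_uniq/iota_uniq.
rewrite big_nat_cond [leRHS]big_nat_cond le_eqVlt; apply/predU1P; left; apply: eq_bigl => k.
rewrite andbT; case: andP => //= -[k_gt0 k_le]; apply/esym/allP => p.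
rewrite mem_primes => /and3P[p_pr _ p_k]; rewrite inE mem_filter p_pr mem_index_iota.
by rewrite prime_gt0 // (leq_ltn_trans (dvdn_leq k_gt0 p_k)).
Qed.

(** The factor at [k] is [k^2 / ((k - 1) (k + 1))]. The value stays below 2 for all [n]. *)
Lemma telescope_squares n :
  \prod_(2 <= k < n.+2) (1 - (k%:R ^+ 2 : R)^-1)^-1 = 2 * n.+1%:R / n.+2%:R.
Proof.
elim: n => [|n IH]; first by rewrite big_geq // mulr1 divff // pnatr_eq0.
rewrite big_nat_recr //= IH -!natr1.
have : (0 : R) <= n%:R by [].
move: (n%:R : R) => x x_ge0.
by field; rewrite !lt0r_neq0 //; nra.
Qed.

(** For [p] prime to [m], [(1 - 1/p)^-1 = (1 + 1/p) (1 - 1/p^2)^-1], and the last factors multiply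
    to at most 2. Each [p] dividing [m] costs at most 2, and there are at most [m] of them. *)
Lemma harmonic_le_psi m n : (0 < m)%N ->
  \sum_(1 <= k < n.+1) (k%:R : R)^-1 <= 2 ^+ m.+1 *
    \prod_(1 <= p < n.+1 | prime p && ~~ (p %| m)%N) (1 + p%:R^-1).
Proof.
move=> m_gt0; apply: (le_trans (smooth_all_primes n)).
have count_small : (\sum_(1 <= k < n.+1) (k <= m) <= m)%N.
  suff -> : (\sum_(1 <= k < n.+1) (k <= m) = minn n m)%N by rewrite geq_minr.
  elim: n => [|n IH]; first by rewrite big_geq // min0n.
  by rewrite big_nat_recr //= IH; lia.
pose sq k : R := if (1 < k)%N then (1 - (k%:R ^+ 2)^-1)^-1 else 1.
have sq_le2 : \prod_(1 <= k < n.+1) sq k <= 2.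
  case: n {count_small} => [|n]; first by rewrite big_geq // ler1n.
  rewrite big_ltn // /sq /= mul1r big_nat_cond.
  rewrite (eq_bigr (fun k => (1 - (k%:R ^+ 2)^-1)^-1)); last first.
    by move=> k /andP[/andP[-> _] _].
  rewrite -big_nat_cond telescope_squares ler_pdivrMr ?ltr0n //.
  by rewrite ler_pM2l ?ltr0n // ler_nat.
pose psi k : R := if prime k && ~~ (k %| m)%N then 1 + k%:R^-1 else 1.
(* The comparison is made factor by factor. The three factors on the right are at least 1, so
   composite [k] do no harm; the power of 2 pays for the primes dividing [m]. *)
apply: (@le_trans _ _ (\prod_(1 <= k < n.+1) (2 ^+ (k <= m)%N * psi k * sq k))).
  rewrite big_mkcond big_nat_cond [leRHS]big_nat_cond.
  apply: ler_prod => k /andP[/andP[k_gt0 _] _].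
  have pow_ge1 : 1 <= (2 : R) ^+ (k <= m)%N by rewrite exprn_ege1 // ler1n.
  have sq_ge1 : 1 <= sq k.
    rewrite /sq; case: ifP => // k_gt1.
    have k2_gt1 : 1 < (k%:R : R) ^+ 2 by rewrite exprn_egt1 // ltr1n.
    rewrite invf_ge1 ?subr_gt0 ?invf_lt1 ?(lt_trans ltr01 k2_gt1) //.
    by rewrite gerBl invr_ge0 sqr_ge0.
  have le_pow_sq (x : R) : 0 <= x -> x <= 2 ^+ (k <= m)%N * x.
    by move=> x_ge0; rewrite ler_peMl.
  have [k_pr|k_npr] := boolP (prime k); last first.
    by rewrite ler01 /= /psi (negPf k_npr) mulr1 mulr_ege1.
  have k_gt1 : 1 < (k%:R : R) by rewrite ltr1n prime_gt1.
  have kV_lt1 : (k%:R : R)^-1 < 1 by rewrite invf_lt1 // (lt_trans ltr01 k_gt1).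
  have kV_ge0 : 0 <= (k%:R : R)^-1 by rewrite invr_ge0.
  rewrite invr_ge0 subr_ge0 ltW //= /psi k_pr /=.
  have [k_m|k_m] := boolP (k %| m)%N; last first.
    have -> : (1 - (k%:R : R)^-1)^-1 = (1 + k%:R^-1) * sq k.
      rewrite /sq prime_gt1 //.
      have : k%:R ^+ 2 - 1 != 0 :> R by rewrite lt0r_neq0 // subr_gt0 exprn_egt1.
      have : k%:R - 1 != 0 :> R by rewrite lt0r_neq0 // subr_gt0.
      have : k%:R != 0 :> R by rewrite lt0r_neq0 // (lt_trans ltr01 k_gt1).
      by move=> ? ? ?; field; do ?[apply/andP; split].
    rewrite -mulrA le_pow_sq // mulr_ge0 ?(le_trans ler01 sq_ge1) //.
    by rewrite addr_ge0.
  rewrite dvdn_leq // mulr1 (@le_trans _ _ 2) ?ler_peMr //.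
  rewrite invf_ple ?posrE ?subr_gt0 //.
  rewrite lerBrDl -lerBrDr (_ : 1 - 2^-1 = 2^-1 :> R); last by field.
  by rewrite lef_pV2 ?posrE ?ltr0n // ler_nat prime_gt1.
rewrite !big_split /= prodrXr exprSr [X in _ <= _ * X]big_mkcond /= mulrAC.
have psi_ge0 k : 0 <= psi k by rewrite /psi; case: ifP => _; rewrite ?addr_ge0 ?invr_ge0.
have sq_ge0 k : 0 <= sq k.
  rewrite /sq; case: ifP => // k_gt1; rewrite invr_ge0 subr_ge0 invf_le1.
    by rewrite exprn_ege1 // ler1n ltnW.
  by rewrite exprn_gt0 // ltr0n ltnW.
rewrite ler_wpM2r ?prodr_ge0 // ler_pM ?exprn_ge0 ?prodr_ge0 //.
by rewrite ler_eXn2l ?ltr1n.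
Qed.
Lemma prod_succV (s : seq nat) : all (leq 1) s ->
  \prod_(p <- s) (1 + (p%:R : R)^-1) =
    (\prod_(p <- s) p.+1)%N%:R / (\prod_(p <- s) p)%N%:R.
Proof.
move=> /allP s_gt0; rewrite !natr_prod -prodf_div big_seq [RHS]big_seq.
apply: eq_bigr => p /s_gt0 p_gt0.
by rewrite -natr1 mulrDl mul1r divff // pnatr_eq0 -lt0n.
Qed.
End Euler.

Local Close Scope ring_scope.

(** * Transfer to [r3] and to the real logarithm *)

Lemma uniq_NoDup (T : eqType) (s : seq T) : uniq s -> NoDup s.
Proof.
elim: s => [|x s IH] /=; first by constructor.
case/andP=> xs /IH s_nodup; constructor=> //; apply: contraNnot xs.
elim: s {IH s_nodup} => //= y s IH [->|/IH]; rewrite inE ?eqxx // => ->.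
by rewrite orbT.
Qed.

Lemma In_mem (T : eqType) (x : T) (s : seq T) : In x s -> x \in s.
Proof. by elim: s => //= y s IH [->|/IH xs]; rewrite inE ?eqxx // xs orbT. Qed.

(** The triples counted on the left are nonnegative representations of [n]. A coordinate is at most
    its square, hence at most [n], so they lie in the box searched by [r3]. *)
Lemma count_cube_r3 n M : count (fun t => sqsum t == n) (cube M) <= r3 n.
Proof.
pose f (t : nat * (nat * nat)) := (Z.of_nat t.1, (Z.of_nat t.2.1, Z.of_nat t.2.2)).
rewrite -size_filter -[size _](length_map f) /r3.
apply/ssrnat.leP/NoDup_incl_length.
  apply: NoDup_map_NoDup_ForallPairs.
    move=> [x [y z]] [x' [y' z']] _ _ [].
    by move=> /Nat2Z.inj -> /Nat2Z.inj -> /Nat2Z.inj ->.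
  exact/uniq_NoDup/filter_uniq/cube_uniq.
move=> _ /in_map_iff[[x [y z]] [<- /In_mem]]; rewrite mem_filter => /andP[/eqP E _].
rewrite /sqsum /= in E.
have sq_ge k : k <= k ^ 2 by case: k => // k; rewrite expnS leq_pmulr.
have in_box k : k <= n -> In (Z.of_nat k) (box n).
  move=> k_n; apply/in_map_iff; exists (k + n); split; first by lia.
  by apply/in_seq; split; lia.
apply/filter_In; split; last by apply/Z.eqb_eq; rewrite /f /=; nia.
apply/in_prod_iff; split; last (apply/in_prod_iff; split); apply: in_box.
  + by rewrite -E -addnA (leq_trans (sq_ge x)) ?leq_addr.
  + by rewrite -E addnAC (leq_trans (sq_ge y)) ?leq_addl.
  + by rewrite -E (leq_trans (sq_ge z)) ?leq_addl.
Qed.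

Lemma ln_le_harmonic (n : nat) :
  (ln (n.+1%:R) <= \sum_(1 <= k < n.+1) (k%:R : R)^-1)%R.
Proof.
elim: n => [|n IH]; first by rewrite big_geq // ln_1.
rewrite big_nat_recr //= -natr1.
have n_gt0 : (0 < n.+1%:R :> R)%R by rewrite ltr0n.
apply: le_trans (lerD IH (lexx _)).
by apply/RleP/ln_succ_le/RltP.
Qed.

Lemma modn_modulo n m : 0 < m -> n %% m = Nat.modulo n m.
Proof.
move=> m_gt0; apply: (Nat.mod_unique _ _ (n %/ m)); first by apply/ssrnat.ltP; rewrite ltn_mod.
by rewrite multE plusE mulnC -divn_eq.
Qed.

Lemma expn_pow x n : x ^ n = Nat.pow x n.
Proof. by elim: n => // n IH; rewrite expnS IH. Qed.

(** The outcome of the counting, phrased with standard-library operations. [D] and [psi] are the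
    products of [p] and of [p + 1] over the primes [p <= y] not dividing [2 m]. *)
Lemma large_r3 (m y z1 z2 z3 : nat) : lt 0 m ->
  exists n D psi : nat,
    and (and (lt 0 D) (le D (Nat.pow y y))) (and
    (and (lt n (Nat.mul 3 (Nat.pow (Nat.mul m D) 2)))
         (Nat.modulo n m =
          Nat.modulo (Nat.add (Nat.add (Nat.pow z1 2) (Nat.pow z2 2)) (Nat.pow z3 2)) m))
    (and (le psi (Nat.mul (Nat.mul 3 m) (r3 n)))
      (Rle (ln (INR y.+1)) (Rmult (pow 2 (S (Nat.mul 2 m))) (Rdiv (INR psi) (INR D)))))).
Proof.
move=> /ssrnat.ltP m_gt0.
pose s := [seq p <- index_iota 1 y.+1 | prime p && ~~ (p %| 2 * m)].
have s_uniq : uniq s by rewrite filter_uniq // iota_uniq.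
have s_pr : all (fun p => [&& prime p, odd p & coprime m p]) s.
  apply/allP => p; rewrite mem_filter => /andP[/andP[p_pr]].
  rewrite Euclid_dvdM // negb_or => /andP[p_2 p_m] _; rewrite p_pr coprime_sym.
  rewrite prime_coprime // p_m andbT; case: (even_prime p_pr) => // p2.
  by rewrite p2 in p_2.
have [n [n_lt n_mod psi_le]] := popular_value (z1, (z2, z3)) m_gt0 s_uniq s_pr.
exists n, (\prod_(p <- s) p), (\prod_(p <- s) p.+1); split; [split | split; [split | split]].
- apply/ssrnat.ltP; rewrite big_seq; apply: prodn_cond_gt0 => p ps.
  by have /and3P[/prime_gt0] := allP s_pr p ps.
- apply/ssrnat.leP; rewrite -expn_pow.
  have size_s : size s <= y.
    by rewrite size_filter (leq_trans (count_size _ _)) // size_iota subn1.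
  apply: (@leq_trans (y ^ size s)).
    rewrite big_seq; apply: (@leq_trans (\prod_(p <- s | p \in s) y)).
      by apply: leq_prod => p; rewrite mem_filter mem_index_iota => /and3P[_ _].
    by rewrite -big_seq big_const_seq count_predT iter_muln_1.
  (* At [y = 0] the list of primes is empty and both powers are [0 ^ 0 = 1]. *)
  case: (posnP y) => [y0|y_gt0]; last by rewrite leq_pexp2l.
  by move: size_s; rewrite y0 leqn0 => /eqP ->.
- by apply/ssrnat.ltP; move: n_lt; rewrite [X in 3 * X]expn_pow.
- by move: n_mod; rewrite !modn_modulo // /sqsum /= !expn_pow.
- apply/ssrnat.leP; exact: leq_trans psi_le (leq_mul (leqnn _) (count_cube_r3 _ _)).
- rewrite multE !INRE !RealsE.
  (* Taking [2 * m] as the modulus excludes the prime 2 as well, whence the exponent [S (2 m)]. *)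
  have := harmonic_le_psi R y (_ : 0 < 2 * m); rewrite muln_gt0 => /(_ m_gt0).
  move/(le_trans (ln_le_harmonic y)); rewrite -big_filter -/s.
  rewrite prod_succV.
    by move/RleP.
  by apply: sub_all s_pr => p /and3P[/prime_gt0].
Qed.

End CountingModulo.

(** * Growth estimates and the choice of constants *)

(** The size of the box is a crude bound, but it shows that a large [r3 n] forces a large [n]. *)
Lemma r3_le (n : nat) : (r3 n <= (2 * n + 1) ^ 3)%nat.
Proof.
unfold r3; eapply Nat.le_trans; [apply filter_length_le |].
rewrite !length_prod; unfold box; rewrite !length_map, length_seq; simpl; lia.
Qed.

(** From [3 m^2 D^2 <= y * y^(2 y) <= y^(3 y)] one gets [ln n <= 3 y ln y <= 3 y^2 <= y^3]. *)
Lemma ln_ln_le (m y D n : nat) :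
  (3 <= y)%nat -> (3 * m ^ 2 <= y)%nat -> (D <= y ^ y)%nat ->
  (1 < n)%nat -> (n < 3 * (m * D) ^ 2)%nat ->
  ln (ln (INR n)) <= 3 * ln (INR y).
Proof.
intros y3 ym Dy n1 nlt.
assert (n_le : (n <= y ^ (3 * y))%nat).
{ apply Nat.lt_le_incl; eapply Nat.lt_le_trans; [exact nlt |].
  apply Nat.le_trans with (y * (y ^ y * y ^ y))%nat.
  - replace (3 * (m * D) ^ 2)%nat with (3 * m ^ 2 * (D * D))%nat by (simpl; lia).
    now apply Nat.mul_le_mono; [| apply Nat.mul_le_mono].
  - rewrite <- Nat.pow_add_r, <- Nat.pow_succ_r'. apply Nat.pow_le_mono_r; lia. }
assert (Hy : 3 <= INR y) by (apply le_INR in y3; simpl in y3; lra).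
assert (Hn : 1 < INR n) by (apply lt_INR in n1; simpl in n1; lra).
assert (ln_y : 0 < ln (INR y) <= INR y).
{ split; [rewrite <- ln_1; apply ln_increasing; lra |].
  rewrite <- (ln_exp (INR y)) at 2; left; apply ln_increasing; [lra |].
  pose proof (exp_ineq1 (INR y)); lra. }
assert (ln_n : 0 < ln (INR n) <= INR y ^ 3).
{ split; [rewrite <- ln_1; apply ln_increasing; lra |].
  apply Rle_trans with (ln (INR (y ^ (3 * y)))).
  - apply le_INR in n_le; destruct n_le as [lt_n | ->]; [|lra].
    left; apply ln_increasing; lra.
  - rewrite pow_INR, ln_pow, mult_INR by lra; simpl.
    assert (INR y * ln (INR y) <= INR y * INR y) by (apply Rmult_le_compat_l; lra).
    assert (3 * (INR y * INR y) <= INR y * (INR y * INR y)).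
    { apply Rmult_le_compat_r; [apply Rmult_le_pos |]; lra. }
    lra. }
replace 3 with (INR 3) by (simpl; ring).
rewrite <- ln_pow by lra.
destruct (proj2 ln_n) as [lt_n | ->]; [|lra].
left; apply ln_increasing; lra.
Qed.

Lemma sum_squares_mod (x y z m : Z) :
  ((x mod m * (x mod m) + y mod m * (y mod m) + z mod m * (z mod m)) mod m
   = (x * x + y * y + z * z) mod m)%Z.
Proof.
assert (sq : forall u, ((u mod m * (u mod m)) mod m = (u * u) mod m)%Z).
{ intros u; rewrite Zmult_mod_idemp_l; apply Zmult_mod_idemp_r. }
assert (add : forall u v u' v', (u mod m = u' mod m -> v mod m = v' mod m ->
    (u + v) mod m = (u' + v') mod m)%Z).
{ intros u v u' v' Eu Ev; rewrite (Zplus_mod u), (Zplus_mod u'), Eu, Ev; reflexivity. }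
apply add; [apply add |]; apply sq.
Qed.

Theorem theorem1p1 :
  forall m : Z, (0 < m)%Z ->
  exists c : R, 0 < c /\
    forall a : Z, sum3sq_mod m a ->
    forall N : nat, exists n : nat,
      (N < n)%nat /\ (0 < n)%nat /\
      (Z.of_nat n mod m = a mod m)%Z /\
      INR (r3 n) >= c * sqrt (INR n) * ln (ln (INR n)).
Proof.
intros mZ mZ_gt0.
destruct (Z_of_nat_complete mZ) as [m ->]; [lia |].
assert (m_gt0 : (0 < m)%nat) by lia.
assert (m_ge1 : 1 <= INR m) by (apply (le_INR 1); lia).
set (K := 2 ^ S (2 * m)).
assert (K_gt0 : 0 < K) by (apply pow_lt; lra).
assert (mK_gt0 : 0 < INR m * K) by (apply Rmult_lt_0_compat; lra).
assert (c_gt0 : 0 < 18 * INR m * INR m * K).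
{ assert (0 < INR m * (INR m * K)) by (apply Rmult_lt_0_compat; lra); lra. }
(* 18 is [2 * 3 * 3], from [sqrt n <= 2 m D], [ln (ln n) <= 3 ln y] and [D ln y <= 3 m K r3 n]. *)
exists (/ (18 * INR m * INR m * K)); split.
{ now apply Rinv_0_lt_compat. }
intros a (z1 & z2 & z3 & Ha) N.
(* The successor ensures [1 < n], so that [ln n] is positive in [ln_ln_le]. *)
set (M := (S N)).
(* [y] is so large that [n <= M] would contradict [D ln y <= 3 m K r3 n], since then
   [r3 n <= (2 M + 1)^3]. *)
destruct (INR_unbounded (exp (3 * INR m * K * INR ((2 * M + 1) ^ 3)))) as [y0 Hy0].
set (y := (y0 + 3 + 3 * m ^ 2)%nat).
set (red := fun z => Z.to_nat (z mod Z.of_nat m)).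
destruct (CountingModulo.large_r3 y (red z1) (red z2) (red z3) m_gt0)
  as (n & D & psi & (D_gt0 & D_le) & (n_lt & n_mod) & psi_le & Hln).
assert (D_ge1 : 1 <= INR D) by (apply (le_INR 1); lia).
assert (y_ge : INR y0 <= INR y) by (apply le_INR; lia).
assert (y_ge3 : 3 <= INR y) by (replace 3 with (INR 3) by (simpl; ring); apply le_INR; lia).
assert (ln_yS : ln (INR y) <= ln (INR (S y))).
{ left; apply ln_increasing; [lra | apply lt_INR; lia]. }
assert (r3_ge : INR D * ln (INR y) <= 3 * INR m * K * INR (r3 n)).
{ assert (psiR : INR psi <= 3 * INR m * INR (r3 n)).
  { apply le_INR in psi_le; rewrite !mult_INR in psi_le; simpl in psi_le; lra. }
  apply Rle_trans with (K * INR psi).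
  - replace (K * INR psi) with (INR D * (K * (INR psi / INR D))) by (field; lra).
    apply Rmult_le_compat_l; [lra |]; fold K in Hln; lra.
  - apply Rle_trans with (K * (3 * INR m * INR (r3 n))); [|lra].
    apply Rmult_le_compat_l; lra. }
assert (n_gt : (M < n)%nat).
{ apply Nat.nle_gt; intros n_le.
  assert (r3_small : INR (r3 n) <= INR ((2 * M + 1) ^ 3)).
  { apply le_INR; eapply Nat.le_trans; [apply r3_le |].
    apply Nat.pow_le_mono_l; lia. }
  assert (ln_big : 3 * INR m * K * INR ((2 * M + 1) ^ 3) < ln (INR y)).
  { rewrite <- (ln_exp (3 * INR m * K * _)); apply ln_increasing; [apply exp_pos | lra]. }
  assert (ln_pos : 0 < ln (INR y)) by (rewrite <- ln_1; apply ln_increasing; lra).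
  assert (3 * INR m * K * INR (r3 n) <= 3 * INR m * K * INR ((2 * M + 1) ^ 3)).
  { apply Rmult_le_compat_l; lra. }
  nra. }
exists n; repeat split; [lia | lia | |].
- rewrite <- Ha. apply (f_equal Z.of_nat) in n_mod.
  rewrite !Nat2Z.inj_mod in n_mod; rewrite n_mod.
  rewrite !Nat2Z.inj_add, !Nat2Z.inj_pow; unfold red.
  rewrite !Z2Nat.id by (apply Z.mod_pos_bound; lia).
  change (Z.of_nat 2) with 2%Z.
  rewrite !Z.pow_2_r.
  apply sum_squares_mod.
- apply Rle_ge.
  assert (lnln : ln (ln (INR n)) <= 3 * ln (INR y)).
  { apply (ln_ln_le m y D n); lia. }
  (* The factor 2 is an upper bound for [sqrt 3], as [n < 3 (m D)^2]. *)
  assert (sqrt_n : 0 <= sqrt (INR n) <= 2 * INR m * INR D).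
  { split; [apply sqrt_pos |].
    rewrite <- (sqrt_Rsqr (2 * INR m * INR D)) by nra.
    apply sqrt_le_1_alt; unfold Rsqr.
    apply lt_INR in n_lt; rewrite mult_INR, pow_INR, mult_INR in n_lt; simpl in n_lt; nra. }
  assert (ln_pos : 0 < ln (INR y)) by (rewrite <- ln_1; apply ln_increasing; lra).
  assert (main : sqrt (INR n) * ln (ln (INR n)) <= 18 * INR m * INR m * K * INR (r3 n)).
  { apply Rle_trans with (2 * INR m * INR D * (3 * ln (INR y))).
    - apply Rle_trans with (sqrt (INR n) * (3 * ln (INR y))).
      + apply Rmult_le_compat_l; lra.
      + apply Rmult_le_compat_r; lra.
    - apply Rle_trans with (6 * INR m * (3 * INR m * K * INR (r3 n))); [|lra].
      replace (2 * INR m * INR D * (3 * ln (INR y))) with (6 * INR m * (INR D * ln (INR y))) by ring.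
      apply Rmult_le_compat_l; lra. }
  rewrite Rmult_assoc.
  apply Rmult_le_reg_l with (18 * INR m * INR m * K).
  { exact c_gt0. }
  rewrite <- Rmult_assoc, Rinv_r, Rmult_1_l; [lra |].
  lra.
Qed.
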